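(* Let $Z$ be a compact Hausdorff space containing (as a subspace) a homeomorphic copy of the one-point compactification $\Delta^+=\Delta\sqcup\{\infty\}$ of an uncountable discrete space $\Delta$, and let $n\ge 3$ be an integer. Set $X:=Z_{[n]}$, $Y:=Z_{[n]}^{\subseteq}$ and let $\pi:Y\to X$ be the second projection $(z,x)\mapsto x$. Then the unital embedding $\pi^*:C(X)\hookrightarrow C(Y)$, $f\mapsto f\circ\pi$, admits no conditional expectation $C(Y)\to \pi^*C(X)$; in particular it is not a quantum (non-commutative) branched cover.
   Context: $Z_{[n]}:=\{\mathbf z\subseteq Z:\ 1\le|\mathbf z|\le n\}$ carries the quotient topology from $Z^n$ via $(z_i)_i\mapsto\{z_i\}_i$ (equivalently, the Vietoris topology); $Z_{[n]}^{\subseteq}:=\{(z,x)\in Z\times Z_{[n]}:\ z\in x\}$. A conditional expectation for a unital $C^*$-subalgebra $A\le B$ is a norm-one idempotent linear map $E:B\to B$ with range $A$ (equivalently a unital completely positive $A$-bimodule projection onto $A$). A unital embedding $A\le B$ is a quantum branched cover if it admits a conditional expectation $E$ of finite index, i.e. there is $K\ge1$ with $KE(b^*b)\ge b^*b$ for all $b\in B$. *)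

(* Defs.v *)
From HB Require Import structures.
From mathcomp Require Import all_boot all_order all_algebra.
From mathcomp Require Import all_classical all_reals all_analysis.
From mathcomp Require Import complex.
Import Order.TTheory GRing.Theory Num.Theory ComplexField.

Set Implicit Arguments.
Unset Strict Implicit.
Unset Printing Implicit Defensive.

Local Open Scope classical_set_scope.
Local Open Scope ring_scope.
Local Open Scope card_scope.

(** The complex numbers [R[i]] (R a realType) with their usual (norm) topology. *)
HB.instance Definition _ (R : rcfType) := PseudoPointedMetric.copy R[i] (R[i])^o.

Definition embedding (A B : topologicalType) (f : A -> B) : Prop :=
  [/\ continuous f, injective f &
      forall U : set A, open U ->
        exists V : set B, open V /\ f @` U = V `&` range f].

Definition Zn_set (Z : Type) (n : nat) : set (set Z) :=
  [set x | x !=set0 /\ (x #<= `I_n)%card].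

Definition Zn (Z : topologicalType) (n : nat) : Type := set_type (@Zn_set Z n).

HB.instance Definition _ (Z : topologicalType) (n : nat) :=
  Choice.copy (Zn Z n) (set_type (@Zn_set Z n)).

Definition vietoris_subbase (Z : topologicalType) (n : nat)
  (p : bool * set Z) : set (Zn Z n) :=
  if p.1 then [set x : Zn Z n | (set_val x) `<=` p.2]
  else [set x : Zn Z n | (set_val x) `&` p.2 !=set0].

HB.instance Definition _ (Z : topologicalType) (n : nat) :=
  @isSubBaseTopological.Build (Zn Z n) (bool * set Z)%type
    [set p | open p.2] (@vietoris_subbase Z n).

Definition Zn_sub_set (Z : topologicalType) (n : nat) : set (Z * Zn Z n) :=
  [set p | set_val p.2 p.1].

Definition Zn_sub (Z : topologicalType) (n : nat) : topologicalType :=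
  set_type (@Zn_sub_set Z n).

Definition Zn_proj (Z : topologicalType) (n : nat) (y : Zn_sub Z n) : Zn Z n :=
  (set_val y).2.

(** Conditional expectation for the unital embedding
    pi^* : C(X) -> C(Y), f |-> f \o pi, with C(T) the C*-algebra of continuous
    complex-valued functions on T (sup norm, pointwise operations).
    E acts on functions Y -> C; only its behaviour on C(Y) matters.
    It is a norm-one idempotent linear map C(Y) -> C(Y) with range pi^* C(X). *)
Definition cond_exp (R : realType) (X Y : topologicalType) (pi : Y -> X)
  (E : (Y -> R[i]) -> (Y -> R[i])) : Prop :=
  [/\
      (forall g : Y -> R[i], continuous g -> continuous (E g)),
      (forall (a : R[i]) (g h : Y -> R[i]), continuous g -> continuous h ->
          E (fun y => a * g y + h y) = (fun y => a * E g y + E h y)),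
      (forall g : Y -> R[i], continuous g -> E (E g) = E g),
      ((forall g : Y -> R[i], continuous g -> exists f : X -> R[i], continuous f /\ E g = f \o pi)
       /\ (forall f : X -> R[i], continuous f ->
             exists g : Y -> R[i], continuous g /\ E g = f \o pi)) &
      ((forall (g : Y -> R[i]) (M : R[i]), continuous g -> (forall y, `|g y| <= M) ->
          forall y, `|E g y| <= M)
       /\ (forall eps : R[i], 0 < eps ->
             exists (g : Y -> R[i]) (y : Y), [/\ continuous g, (forall y', `|g y'| <= 1) &
                                    1 - eps < `|E g y|]))].

(** Quantum branched cover: there is a conditional expectation of finite index,
    i.e. K E(b^* b) >= b^* b in C(Y) for some K >= 1 (order of C(Y) is the
    pointwise order of self-adjoint elements). *)
Definition quantum_branched_cover (R : realType) (X Y : topologicalType)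
  (pi : Y -> X) : Prop :=
  exists E, cond_exp pi E /\
    exists K : R[i], 1 <= K /\
      forall b : Y -> R[i], continuous b ->
        forall y, (b y)^* * b y <= K * E (fun y' => (b y')^* * b y') y.

(* Main.v *)
Require Import Defs.
From HB Require Import structures.
From mathcomp Require Import all_boot all_order all_algebra.
From mathcomp Require Import all_classical all_reals all_analysis.
From mathcomp Require Import complex.
From mathcomp Require Import lra.

Set Implicit Arguments.
Unset Strict Implicit.
Unset Printing Implicit Defensive.

Import Order.TTheory GRing.Theory Num.Theory ComplexField.
Import numFieldNormedType.Exports.
Local Open Scope classical_set_scope.
Local Open Scope ring_scope.

(** A conditional expectation [E] is positive, unital and [C(X)]-linear, so for
    [h] in [C(Z)] the value of [E (h o fst)] at [x] is an average of [h] over the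
    finite set [x], with weights depending continuously on [x].  For [p] in the
    discrete space let [h_p] be a bump function equal to [1] at [p] and to [0] on
    the rest of the one-point compactification, let [f_p(x)] be the average of
    [h_p] over [x] (the weight of [p]), and let [w(p) = f_p({p, oo})].  Since
    [{p, a, b}] tends to [{p, oo}] as [a] and [b] tend to infinity, there is a
    finite set [F(p)] such that [f_p({p, a, b})] is close to [w(p)] for [a], [b]
    outside [F(p)].  As the discrete space is uncountable, some distinct [p], [q],
    [r] avoid each other's sets [F].  Weights sum to [1] on [{p, q}], [{p, r}],
    [{q, r}] and on [{p, q, r}]; the pairs give [w(p) + w(q) + w(r)] close to
    [3/2], whereas the triple gives a sum close to [1]. *)

(** * Countable unions, and neighbourhoods of infinity in the compactification *)

Lemma countable_setU (T : Type) (A B : set T) :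
  countable A -> countable B -> countable (A `|` B).
Proof.
move=> cA cB; rewrite -bigcup2E; apply: bigcup_countable => //.
by move=> [|[|i]] _.
Qed.

(** If [A] were infinite, the sets containing all but finitely many points of [A] would form a
    proper filter containing [A]. It clusters at no [x], since it contains [A] minus [x], which
    misses the open set [[set x]]. *)
Lemma finite_discrete_compact (T : discreteTopologicalType) (A : set T) :
  compact A -> finite_set A.
Proof.
move=> cA; apply: contrapT => infA.
pose G := [set B : set T | finite_set (A `\` B)].
have FG : ProperFilter G.
  apply: Build_ProperFilter; first by rewrite /G /= setD0.
  split; rewrite /G.
  - by rewrite /= setDT.
  - move=> P Q /= fP fQ; rewrite [X in finite_set X](_ : _ = A `\` P `|` A `\` Q).
      by rewrite finite_setU.
    exact: setDIr.
  - by move=> P Q PQ; apply: sub_finite_set; exact: setDS.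
have [|x [Ax clx]] := cA G _; first by rewrite /G /= setDv.
have [|y [[_ nyx] yx]] := clx (A `\ x) [set x] _ (discrete_set1 x).
  by rewrite /G /= setDD; apply: sub_finite_set (finite_set1 x) => z [].
exact: nyx.
Qed.

Lemma infinity_nbhs_cofinite (D : choiceType)
    (U : set (one_point_compactification (discrete_topology D))) :
  nbhs (None : one_point_compactification (discrete_topology D)) U ->
  finite_set [set d : D | ~ U (Some d)].
Proof.
move=> [C [/finite_discrete_compact fC _] CU].
apply: sub_finite_set fC => d /= nUd; apply: contrapT => nCd.
by apply: nUd; apply: CU; left; exists d.
Qed.

(** * Free sets for a set mapping with finite values *)

Section free_set.
Context (T : choiceType) (F : T -> set T).
Context (Fin : forall x, finite_set (F x)) (unc : ~ countable [set: T]).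

Definition free (s : seq T) :=
  uniq s /\ {in s &, forall a b, a != b -> ~ F a b}.

(** The countable set [C] to be avoided strengthens the induction: thanks to it, the case [k] yields
    free sequences disjoint from those already built. *)
Lemma uncountable_free_seq (k : nat) (C : set T) : countable C ->
  exists s : seq T, [/\ size s = k, free s & forall a, a \in s -> ~ C a].
Proof.
elim: k C => [|k IH] C cC; first by exists [::].
have /choice[S SP] : forall C : set T, exists s : seq T, countable C ->
    [/\ size s = k, free s & forall a, a \in s -> ~ C a].
  (* For uncountable [B] the empty sequence serves as a default value. *)
  move=> B; have [cB|] := pselect (countable B); last by exists [::].
  by have [s ?] := IH B cB; exists s.
(* Iterating the induction hypothesis gives infinitely many disjoint free
   sequences; a point [r] outside their F-neighbourhood has a finite [F r],
   which misses at least one of them. *)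
pose fix B n := if n is m.+1 then B m `|` [set` S (B m)] else C.
have cB n : countable (B n).
  elim: n => //= n IHn; apply: countable_setU => //.
  exact/finite_set_countable/finite_seq.
have BS m n : (m <= n)%N -> B m `<=` B n.
  move=> /subnK <-; elim: (n - m)%N => // j IHj.
  by rewrite addSn /=; apply: subset_trans IHj _ => x; left.
pose A := \bigcup_n B n.
have cA : countable A by apply: bigcup_countable.
pose G := A `|` \bigcup_(a in A) F a.
have cG : countable G.
  apply: countable_setU => //; apply: bigcup_countable => // a _.
  exact: finite_set_countable.
have [r nGr] : exists r, ~ G r.
  apply: contra_notP unc => /forallNP GT.
  by rewrite (_ : [set: T] = G)//; apply/seteqP; split => // x _; apply: contrapT.
(* As [r] is outside [G], [~ F a r] already holds for every [a] in [A]; the choice of [n] supplies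
   the reverse condition. *)
have [n nF] : exists n, forall a, a \in S (B n) -> ~ F r a.
  apply: contrapT => /forallNP h.
  have /choice[c cP] : forall n, exists a, a \in S (B n) /\ F r a.
    by move=> n; have /existsNP[a /not_implyP[? /contrapT ?]] := h n; exists a.
  have cn m n : (m < n)%N -> c m <> c n.
    move=> mn cmn; have [_ _ /(_ (c n) (cP n).1)] := SP _ (cB n).
    by apply; rewrite -cmn; apply: (BS m.+1) => //=; right; exact: (cP m).1.
  have cinj : {in [set: nat] &, injective c}.
    move=> m p _ _ cmp; case: (ltngtP m p) => // /cn; first by move/(_ cmp).
    by move/(_ (esym cmp)).
  apply: infinite_nat; rewrite -(eq_finite_set (inj_card_eq cinj)).
  by apply: sub_finite_set (Fin r) => _ [n _ <-]; exact: (cP n).2.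
have [Ssz [Su Sf] SC] := SP _ (cB n).
have nA a : a \in S (B n) -> A a by move=> aS; exists n.+1 => //; right.
exists (r :: S (B n)); split; first by rewrite /= Ssz.
  split => /=; first by rewrite Su andbT; apply/negP => /nA Ar; apply: nGr; left.
  move=> a b; rewrite !inE => /predU1P[->|aS] /predU1P[->|bS]; last exact: Sf.
  - by rewrite eqxx.
  - by move=> _; exact: nF.
  - by move=> _ Far; apply: nGr; right; exists a => //; exact: nA.
move=> a; rewrite inE => /predU1P[->|aS].
  by move=> Cr; apply: nGr; left; exists 0%N.
by move=> Ca; apply: (SC a aS); apply: (BS 0%N).
Qed.
End free_set.

(** * The Vietoris topology on [Zn] *)

Section vietoris.
Context {Z : topologicalType} {n : nat}.
Implicit Types (x : Zn Z n) (U : set Z).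

Lemma open_vietoris_sub U : open U -> open [set x : Zn Z n | set_val x `<=` U].
Proof.
move=> oU; exists [set [set x : Zn Z n | set_val x `<=` U]]; last first.
  by rewrite bigcup_set1.
move=> _ ->.
exact: (@finI_from1 _ _ [set p | open p.2] (@vietoris_subbase Z n) (true, U)).
Qed.

Lemma open_vietoris_meet U : open U ->
  open [set x : Zn Z n | set_val x `&` U !=set0].
Proof.
move=> oU; exists [set [set x : Zn Z n | set_val x `&` U !=set0]]; last first.
  by rewrite bigcup_set1.
move=> _ ->.
exact: (@finI_from1 _ _ [set p | open p.2] (@vietoris_subbase Z n) (false, U)).
Qed.

Lemma vietoris_continuous (T : topologicalType) (f : T -> Zn Z n) :
  (forall U, open U -> open [set t | set_val (f t) `<=` U]) ->
  (forall U, open U -> open [set t | set_val (f t) `&` U !=set0]) ->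
  continuous f.
Proof.
move=> fsub fmeet; apply/continuousP => _ [G GI <-].
rewrite preimage_bigcup; apply: bigcup_open => A /GI[I ID <-].
rewrite preimage_bigcap openE => t ft.
apply: filter_bigI => p pI; apply: open_nbhs_nbhs; split; last exact: ft.
by case: p {ft} pI => [[] U] /ID; rewrite inE /= => oU; [exact: fsub|exact: fmeet].
Qed.

(** Of the two kinds of subbasic open sets, containment gives upper semicontinuity of the supremum
    and meeting gives lower semicontinuity. *)
Lemma sup_vietoris_continuous (R : realType) (k : Z -> R) (M : R) :
  continuous k -> (forall z, k z <= M) ->
  continuous (fun x : Zn Z n => sup (k @` set_val x)).
Proof.
move=> kc kM x; apply/(@cvgrPdist_le _ _ _ _ (nbhs_filter x)) => e e0.
have supx x' : has_sup (k @` set_val x').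
  split; last by exists M => _ [z _ <-].
  by apply: image_nonempty; case: (set_valP x').
have ub x' z : set_val x' z -> k z <= sup (k @` set_val x').
  by move=> xz; apply: ub_le_sup; [exact: (supx x').2|exists z].
pose s := sup (k @` set_val x).
have N1 : nbhs x [set x' : Zn Z n | set_val x' `<=` k @^-1` [set t | t < s + e]].
  apply: open_nbhs_nbhs; split.
    by apply: open_vietoris_sub; move/continuousP : kc; apply; exact: open_lt.
  by move=> z /ub /= /le_lt_trans; apply; rewrite ltrDl.
have N2 : nbhs x
    [set x' : Zn Z n | set_val x' `&` k @^-1` [set t | s - e < t] !=set0].
  apply: open_nbhs_nbhs; split.
    by apply: open_vietoris_meet; move/continuousP : kc; apply; exact: open_gt.
  by have [_ [z xz <-] lt] := sup_adherent e0 (supx x); exists z.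
near=> x'.
have x1 : set_val x' `<=` k @^-1` [set t | t < s + e] by near: x'; exact: N1.
have [z [x'z /= sz]] : set_val x' `&` k @^-1` [set t | s - e < t] !=set0.
  by near: x'; exact: N2.
have ux' : sup (k @` set_val x') <= s + e.
  by apply: ge_sup; [exact: (supx x').1|move=> _ [y /x1 /ltW ? <-]].
have := ub _ _ x'z; rewrite ler_distlC => lz.
by rewrite -/s ux' (le_trans (ltW sz)).
Unshelve. all: by end_near. Qed.

End vietoris.

(** * Triples, possibly degenerate, as points of [Zn] *)

Section triple.
Context {Z : topologicalType} {n : nat} (hn : (3 <= n)%N).

Lemma triple_Zn_set (a b c : Z) : Zn_set n [set a; b; c].
Proof.
split; first by exists a; left; left.
pose g i := if i is i'.+1 then if i' is 0 then b else c else a.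
have -> : [set a; b; c] = g @` `I_3.
  apply/seteqP; split => [z [[->|->]|->]|_ [i i3 <-]].
  - by exists 0%N.
  - by exists 1%N.
  - by exists 2%N.
  - by case: i i3 => [|[|[]]] // _; [left; left|left; right|right].
apply: card_le_trans (card_image_le _ _) (subset_card_le _).
by move=> i /leq_trans; exact.
Qed.

(** Coincidences are allowed, so [triple a b b] is the pair of [a] and [b]: pairs and genuine
    triples lie in one continuous family. *)
Definition triple (a b c : Z) : Zn Z n := SigSub (mem_set (triple_Zn_set a b c)).

Lemma triple_continuous (c : Z) :
  continuous (fun ab : Z * Z => triple c ab.1 ab.2).
Proof.
have oP (i : Z * Z -> Z) U : continuous i -> open U -> open (i @^-1` U).
  by move=> /continuousP; apply.
have c1 : continuous (fst : Z * Z -> Z) by move=> ?; exact: cvg_fst.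
have c2 : continuous (snd : Z * Z -> Z) by move=> ?; exact: cvg_snd.
apply: vietoris_continuous => U oU.
- rewrite (_ : mkset _ = cst c @^-1` U `&` fst @^-1` U `&` snd @^-1` U).
    by do 2 (apply: openI; last exact: oP); apply: oP => // ?; exact: cvg_cst.
  apply/seteqP; split => [ab sU|ab [[Uc U1] U2] z [[->|->]|->]//].
  by split; [split|]; apply: sU; [left; left|left; right|right].
- rewrite (_ : mkset _ = cst c @^-1` U `|` fst @^-1` U `|` snd @^-1` U).
    by do 2 (apply: openU; last exact: oP); apply: oP => // ?; exact: cvg_cst.
  apply/seteqP; split => [ab [z [[[->|->]|->] Uz]]|ab [[Uz|Uz]|Uz]].
  - by left; left.
  - by left; right.
  - by right.
  - by exists c; split => //; left; left.
  - by exists ab.1; split => //; left; right.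
  - by exists ab.2; split => //; right.
Qed.

End triple.

(** * Continuity of real and complex valued functions *)

Lemma continuous_scaleD (R : realType) (T : topologicalType) (a : R)
    (u v : T -> R) : continuous u -> continuous v ->
  continuous (fun t => a * u t + v t).
Proof.
move=> uc vc t; apply: cvgD; last exact: vc.
by apply: cvgM; [exact: cvg_cst|exact: uc].
Qed.

Section complex_valued.
Local Open Scope complex_scope.
Context {R : realType} {T : topologicalType}.
Local Notation C := R[i].

(** Balls of [R[i]] have radii in [R[i]] itself; a positive element there is real, so radii can be
    taken in [R]. *)
Lemma nbhs_complexP (c : C) (A : set C) :
  nbhs c A <-> exists2 e : R, 0 < e & forall d, `|c - d| < e%:C -> A d.
Proof.
split => [/nbhs_ballP[e /= e0 eA]|[e e0 eA]].
  have re : e = (complex.Re e)%:C by rewrite RRe_real// gtr0_real.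
  exists (complex.Re e); first by rewrite -ltcR -re.
  by move=> d; rewrite -re => cd; exact: eA.
apply/nbhs_ballP; exists e%:C; first by rewrite /= ltcR.
by move=> d; exact: eA.
Qed.

Lemma continuous_real_complex (u : T -> R) :
  continuous u -> continuous (fun t => (u t)%:C : C).
Proof.
move=> uc t A /nbhs_complexP[e e0 eA].
have /cvgrPdist_lt/(_ e e0) := uc t; apply: filterS => t' tt'; apply: eA.
by rewrite -rmorphB normc_def /= expr0n addr0 sqrtr_sqr ltcR.
Qed.

Lemma continuous_Re (f : T -> C) : continuous f ->
  continuous (fun t => complex.Re (f t)).
Proof.
move=> fc t; apply/(@cvgrPdist_lt _ _ _ _ (nbhs_filter t)) => e e0.
have : nbhs (f t) [set d | `|f t - d| < e%:C].
  by apply/nbhs_complexP; exists e.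
move=> /fc; rewrite nbhs_simpl; apply: (@filterS _ _ (nbhs_filter t)) => t' /=.
rewrite -ltcR; apply: le_lt_trans.
by apply: le_trans (normc_ge_Re _); rewrite raddfB.
Qed.

End complex_valued.

(** * The real part of a conditional expectation *)

Section cond_exp.
Local Open Scope complex_scope.
Context {R : realType} {X Y : topologicalType} (pr : Y -> X).
Context {E : (Y -> R[i]) -> (Y -> R[i])} (HE : cond_exp pr E).
Local Notation C := R[i].

Lemma cond_exp_pullback (f : X -> C) : continuous f -> E (f \o pr) = f \o pr.
Proof.
have [_ _ Eid [_ surj] _] := HE.
move=> /surj[g [gc gf]].
by rewrite -gf Eid.
Qed.

Definition reE (u : Y -> R) (y : Y) : R := complex.Re (E (fun y => (u y)%:C) y).

Lemma reE_linear (a : R) (u v : Y -> R) y : continuous u -> continuous v ->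
  reE (fun y => a * u y + v y) y = a * reE u y + reE v y.
Proof.
have [_ lin _ _ _] := HE => uc vc; rewrite /reE.
rewrite [X in E X](_ : _ = fun y => a%:C * (u y)%:C + (v y)%:C); last first.
  by apply/funext => z; rewrite -rmorphM -rmorphD.
rewrite lin; [|exact: continuous_real_complex..].
by rewrite raddfD /=; case: (E _ y) => b c /=; rewrite mul0r subr0.
Qed.

Lemma reE_pullback (f : X -> R) y : continuous f -> reE (f \o pr) y = f (pr y).
Proof.
move=> /continuous_real_complex fc.
by rewrite /reE (cond_exp_pullback fc).
Qed.

(** A unital contraction is positive: [u] stays within [M / 2] of the constant [M / 2], hence so
    does [reE u]. *)
Lemma reE_ge0 (u : Y -> R) (M : R) y :
  continuous u -> (forall y, 0 <= u y <= M) -> 0 <= reE u y.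
Proof.
move=> uc uM; have c1 : continuous (cst 1 : Y -> R) by exact: cst_continuous.
have [_ _ _ _ [Econtr _]] := HE.
pose v y := - (M / 2) * cst 1 y + u y.
have vc : continuous v by exact: continuous_scaleD.
have vM z : `|(v z)%:C : C| <= (M / 2)%:C.
  rewrite normc_def /= expr0n addr0 sqrtr_sqr lecR /v mulr1 ler_norml.
  by have /andP[u0 u1] := uM z; apply/andP; split; lra.
have := Econtr _ _ (continuous_real_complex vc) vM y.
move=> /(le_trans (normc_ge_Re _)); rewrite lecR ler_norml => /andP[+ _].
rewrite -/(reE v y) (reE_linear _ _ c1 uc) (@reE_pullback (cst 1)); last first.
  exact: cst_continuous.
by rewrite /=; lra.
Qed.

End cond_exp.

(** * Averages over the finite sets, compared fibre by fibre *)

Section fiberwise.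
Context {R : realType} {Z : topologicalType} {n : nat}.
Context {E : (Zn_sub Z n -> R[i]) -> (Zn_sub Z n -> R[i])}.
Context (HE : cond_exp (@Zn_proj Z n) E).
Implicit Types (h k : Z -> R) (y : Zn_sub Z n).

Definition average h y : R := @reE R (Zn_sub Z n) E (fun y => h (set_val y).1) y.

Lemma continuous_set_val : continuous (set_val : Zn_sub Z n -> Z * Zn Z n).
Proof. exact: initial_continuous. Qed.

Lemma continuous_first h : continuous h ->
  continuous (fun y => h (set_val y).1).
Proof.
move=> hc y.
apply: (@continuous_comp _ _ _ (fun y : Zn_sub Z n => (set_val y).1) h);
  last exact: hc.
apply: (@continuous_comp _ _ _ (set_val : Zn_sub Z n -> _) fst).
  exact: continuous_set_val.
exact: cvg_fst.
Qed.

Lemma continuous_Zn_proj : continuous (@Zn_proj Z n).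
Proof.
move=> y; apply: (@continuous_comp _ _ _ (set_val : Zn_sub Z n -> _) snd).
  exact: continuous_set_val.
exact: cvg_snd.
Qed.

Lemma average1 y : average (cst 1) y = 1.
Proof.
have c1 : continuous (cst 1 : Zn Z n -> R) by exact: cst_continuous.
exact: (reE_pullback HE y c1).
Qed.

Lemma averageZD (a : R) h k y : continuous h -> continuous k ->
  average (fun z => a * h z + k z) y = a * average h y + average k y.
Proof.
by move=> hc kc; apply: reE_linear HE _ _ _ _ _ _; exact: continuous_first.
Qed.

Lemma average_ge0 h (M : R) y : continuous h -> (forall z, `|h z| <= M) ->
  (forall z, set_val (Zn_proj y) z -> 0 <= h z) -> 0 <= average h y.
Proof.
move=> hc hM h0.
(* [phi], the largest negative part of [h] over a fibre, is a function on [X]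
   vanishing at the fibre of [y], and [h + phi >= 0] everywhere: this replaces
   the bimodule property of [E]. *)
pose m z := Num.max 0 (- h z).
have mc : continuous m.
  move=> z; apply: (continuous_max (f := cst 0) (g := fun z => - h z)).
    exact: cvg_cst.
  by apply: cvgN; exact: hc.
have mM z : m z <= M.
  rewrite ge_max (le_trans _ (hM z))//= lerNl.
  by have := hM z; rewrite ler_norml => /andP[].
pose phi (x : Zn Z n) := sup (m @` set_val x).
have phic : continuous phi := sup_vietoris_continuous mc mM.
have m_phi (x : Zn Z n) z : set_val x z -> m z <= phi x.
  by move=> xz; apply: ub_le_sup; [exists M => _ [w _ <-]|exists z].
have phiM x : phi x <= M.
  apply: ge_sup; last by move=> _ [w _ <-].
  by apply: image_nonempty; case: (set_valP x).
have phi0 : phi (Zn_proj y) = 0.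
  rewrite /phi (_ : m @` _ = [set 0]) ?sup1//.
  apply/seteqP; split => [_ [z /h0 hz <-]|_ ->].
    by rewrite /m max_l// oppr_le0.
  have [[z xz] _] := set_valP (Zn_proj y).
  by exists z => //; rewrite /m max_l// oppr_le0 h0.
have phipi : continuous (phi \o @Zn_proj Z n).
  by move=> ?; apply: continuous_comp; [exact: continuous_Zn_proj|exact: phic].
pose u y' := 1 * h (set_val y').1 + (phi \o @Zn_proj Z n) y'.
have hu := continuous_first hc.
have uc : continuous u by exact: continuous_scaleD.
have : 0 <= @reE R (Zn_sub Z n) E u y.
  (* On each fibre [phi] dominates [m], hence [- h], so [u] is nonnegative; [h] and [phi] are each
     at most [M], whence the bound [M + M]. *)
  apply: (reE_ge0 HE (M := M + M)) => // y'.
  have xz : set_val (Zn_proj y') (set_val y').1 := set_valP y'.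
  have := m_phi _ _ xz; rewrite ge_max => /andP[p0 ph].
  have := hM (set_val y').1; rewrite ler_norml => /andP[_ h1].
  by rewrite /u mul1r /=; have := phiM (Zn_proj y'); lra.
rewrite (reE_linear HE)// (reE_pullback HE)// phi0 mul1r addr0.
exact.
Qed.

Lemma average_le h k (M : R) y : continuous h -> continuous k ->
  (forall z, `|h z| <= M) -> (forall z, `|k z| <= M) ->
  (forall z, set_val (Zn_proj y) z -> h z <= k z) ->
  average h y <= average k y.
Proof.
move=> hc kc hM kM hk.
have : 0 <= average (fun z => - 1 * h z + k z) y.
  apply: (@average_ge0 _ (M + M)).
  - exact: continuous_scaleD.
  - by move=> z; rewrite (le_trans (ler_normD _ _))// mulN1r normrN lerD.
  - by move=> z /hk; rewrite mulN1r addrC subr_ge0.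
by rewrite averageZD//; lra.
Qed.

End fiberwise.

(** * Product maps, and bump functions at the isolated points *)

Lemma continuous_pair_map (S T : topologicalType) (g : S -> T) :
  continuous g -> continuous (fun ab : S * S => (g ab.1, g ab.2)).
Proof.
move=> gc ab; apply: cvg_pair.
  by apply: (@continuous_comp _ _ _ fst g); [exact: cvg_fst|exact: gc].
by apply: (@continuous_comp _ _ _ snd g); [exact: cvg_snd|exact: gc].
Qed.

Section isolated_points.
Context {R : realType} {Z : topologicalType} {D : choiceType}.
Local Notation Dplus := (one_point_compactification (discrete_topology D)).
Context (Zc : compact [set: Z]) (Zh : hausdorff_space Z).
Context (iota : Dplus -> Z) (iotac : continuous iota) (iotaI : injective iota).

(** Urysohn's lemma in [Z] separates [iota (Some p)] from the image of all other points, infinity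
    included; that image is compact because [Some p] is isolated. *)
Lemma bump_function (p : D) : exists h : Z -> R,
  [/\ continuous h, forall z, 0 <= h z <= 1, h (iota (Some p)) = 1 &
      forall d, d <> Some p -> h (iota d) = 0].
Proof.
pose A : set Dplus := ~` [set Some p].
have cA : compact A.
  apply: (subclosed_compact _ one_point_compactification_compact) => //.
  apply: open_closedC; rewrite -(image_set1 Some p).
  by apply: one_point_compactification_open_some; exact: discrete_open.
have clB : closed (iota @` A).
  apply: compact_closed => //; apply: continuous_compact => //.
  exact: continuous_subspaceT.
have clp : closed [set iota (Some p)].
  exact: accessible_closed_set1 (hausdorff_accessible Zh) _.
have disj : iota @` A `&` [set iota (Some p)] = set0.
  by apply/disjoints_subset => _ [d nd <-] /iotaI.
have /(@normal_separatorP R)/(_ _ _ clB clp disj) := compact_normal Zh Zc.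
move=> /(@uniform_separatorP _ R)[h [hc h01 h0 h1]]; exists h; split => //.
- by move=> z; have /= := h01 _ (imageP h (I : setT z)); rewrite in_itv.
- by apply: (h1 (h _)); exists (iota (Some p)).
- by move=> d dp; apply: (h0 (h (iota d))); exists (iota d) => //; exists d.
Qed.

End isolated_points.

(** * The contradiction between weights on pairs and on triples *)

Theorem mainTheorem2 (R : realType) (Z : topologicalType)
  (hZc : compact [set: Z]) (hZh : hausdorff_space Z)
  (D : choiceType) (hD : ~ countable [set: D])
  (iota : one_point_compactification (discrete_topology D) -> Z)
  (hiota : embedding iota)
  (n : nat) (hn : (3 <= n)%N) :
  ~ (exists E, @cond_exp R (Zn Z n) (Zn_sub Z n) (@Zn_proj Z n) E)
  /\ ~ @quantum_branched_cover R (Zn Z n) (Zn_sub Z n) (@Zn_proj Z n).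
Proof.
suff noE : ~ exists E, @cond_exp R (Zn Z n) (Zn_sub Z n) (@Zn_proj Z n) E.
  by split => // -[E [HE _]]; apply: noE; exists E.
move=> [E HE]; have [iotac iotaI _] := hiota.
have /choice[h hP] := @bump_function R Z D hZc hZh iota iotac iotaI.
have hc p : continuous (h p) by have [] := hP p.
have h01 p z : 0 <= h p z <= 1 by have [_ /(_ z)] := hP p.
have h1 p : h p (iota (Some p)) = 1 by have [] := hP p.
have h0 p d : d <> Some p -> h p (iota d) = 0.
  by move=> dp; have [_ _ _ /(_ d dp)] := hP p.
have hge0 p z : 0 <= h p z by have /andP[] := h01 p z.
(* The range of [E] consists of pullbacks, so the average of [h p] depends only on the fibre, and
   continuously. *)
have /choice[f fP] : forall p, exists f : Zn Z n -> R, continuous f /\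
    forall y, average (E := E) (h p) y = f (Zn_proj y).
  move=> p; have [_ _ _ [rng _] _] := HE.
  have [g [gc gE]] := rng _ (continuous_real_complex (continuous_first (hc p))).
  exists (fun x => complex.Re (g x)); split; first exact: continuous_Re.
  by move=> y; rewrite /average /reE gE.
pose x3 (a b c : Z) := triple hn a b c.
have [y3 y3P] : exists y3 : Z -> Z -> Z -> Zn_sub Z n,
    forall a b c, Zn_proj (y3 a b c) = x3 a b c.
  have sub a b c : Zn_sub_set (a, x3 a b c) by left; left.
  by exists (fun a b c => SigSub (mem_set (sub a b c))).
pose io (d : D) := iota (Some d).
pose w p := f p (x3 (io p) (iota None) (iota None)).
(* With tolerance [e], the pairs give a sum of the three [w] at least [3/2 - 3e] and the triple
   gives one strictly below [1 + 3e]. At [e = 1/12] both bounds equal [5/4], so strictness yields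
   the contradiction. *)
have /choice[F FP] : forall p, exists F : set D, finite_set F /\
    forall a b, ~ F a -> ~ F b -> `|w p - f p (x3 (io p) (io a) (io b))| < 12^-1.
  move=> p.
  pose q (ab : one_point_compactification (discrete_topology D) *
               one_point_compactification (discrete_topology D)) :=
    f p (x3 (io p) (iota ab.1) (iota ab.2)).
  have qc : continuous q.
    move=> ab; apply: (@continuous_comp _ _ _
      (fun ab => x3 (io p) (iota ab.1) (iota ab.2)) (f p)); last exact: (fP p).1.
    apply: (@continuous_comp _ _ _ (fun ab => (iota ab.1, iota ab.2))
      (fun uv : Z * Z => x3 (io p) uv.1 uv.2)); last exact: triple_continuous.
    exact: continuous_pair_map.
  have /cvgrPdist_lt/(_ 12^-1 _)[|[U V] /= [nU nV] UV] := qc (None, None).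
    by rewrite invr_gt0.
  (* Points outside this finite set lie in both sides of the rectangle [U], [V] around
     [(None, None)]. *)
  exists ([set d | ~ U (Some d)] `|` [set d | ~ V (Some d)]); split.
    by rewrite finite_setU; split; exact: infinity_nbhs_cofinite.
  move=> a b /not_orP[/contrapT Ua _] /not_orP[_ /contrapT Vb].
  exact: (UV (Some a, Some b)).
have [s [size_s [uniq_s free_s] _]] :=
  @uncountable_free_seq D F (fun p => (FP p).1) hD 3 _ (countable0 D).
case: s size_s uniq_s free_s => [|p [|q [|r []]]] //= _ uniq_s free_s.
have hio a b : a != b -> h a (io b) = 0.
  by move=> ab; apply: h0 => -[ba]; rewrite ba eqxx in ab.
have avg1 y : average (E := E) (cst 1) y = 1 := average1 HE y.
have c1 : continuous (cst 1 : Z -> R) by exact: cst_continuous.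
have c1M (M : R) : 1 <= M -> forall z : Z, `|(cst 1 : Z -> R) z| <= M.
  by move=> M1 z; rewrite normr1.
(* One fibre is read in two ways, as [a] with [b] doubled and as [b] with [a] doubled, so that both
   [FP a] and [FP b] apply, each with error [1/12]. *)
have pair a b : a != b -> ~ F a b -> ~ F b a -> 1 - 6^-1 <= w a + w b.
  move=> ab Fab Fba; pose y := y3 (io a) (io b) (io b).
  have yab : Zn_proj y = x3 (io a) (io b) (io b) := y3P _ _ _.
  have yba : Zn_proj y = x3 (io b) (io a) (io a).
    rewrite yab; apply/val_inj => /=; apply/seteqP.
    by split => z [[->|->]|->]; by [right | left; left].
  (* The factor [1] fits the form [a * h + k] of [averageZD]. *)
  have hc2 : continuous (fun z => 1 * h a z + h b z) by exact: continuous_scaleD.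
  have hM z : `|1 * h a z + h b z| <= 2.
    by have := h01 a z; have := h01 b z; rewrite ler_norml; lra.
  have : average (E := E) (cst 1) y <=
         average (E := E) (fun z => 1 * h a z + h b z) y.
    apply: (average_le HE c1 hc2 (c1M 2 _) hM) => [|z]; first by lra.
    rewrite yab /= => -[[->|->]|->]; rewrite mul1r.
    - by rewrite h1 lerDl.
    - by rewrite h1 lerDr.
    - by rewrite h1 lerDr.
  rewrite avg1 (averageZD HE)// !(fP _).2 {1}yab yba.
  have := (FP a).2 b b Fab Fab; have := (FP b).2 a a Fba Fba.
  rewrite !ltr_norml; lra.
move: uniq_s; rewrite !inE negb_or => /and3P[/andP[pq pr] qr _].
have FN a b : a \in [:: p; q; r] -> b \in [:: p; q; r] -> a != b -> ~ F a b.
  exact: free_s.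
have Fpq : ~ F p q by apply: FN; rewrite ?inE ?eqxx ?orbT.
have Fpr : ~ F p r by apply: FN; rewrite ?inE ?eqxx ?orbT.
have Fqr : ~ F q r by apply: FN; rewrite ?inE ?eqxx ?orbT.
have Fqp : ~ F q p by apply: FN; rewrite ?inE ?eqxx ?orbT // eq_sym.
have Frp : ~ F r p by apply: FN; rewrite ?inE ?eqxx ?orbT // eq_sym.
have Frq : ~ F r q by apply: FN; rewrite ?inE ?eqxx ?orbT // eq_sym.
pose y := y3 (io p) (io q) (io r).
have yp : Zn_proj y = x3 (io p) (io q) (io r) := y3P _ _ _.
have yq : Zn_proj y = x3 (io q) (io p) (io r).
  rewrite yp; apply/val_inj => /=; apply/seteqP.
  by split => z [[->|->]|->]; by [right | left; left | left; right].
have yr : Zn_proj y = x3 (io r) (io p) (io q).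
  rewrite yp; apply/val_inj => /=; apply/seteqP.
  by split => z [[->|->]|->]; by [right | left; left | left; right].
pose k z := 1 * h q z + h r z.
have kc : continuous k by exact: continuous_scaleD.
have hc3 : continuous (fun z => 1 * h p z + k z) by exact: continuous_scaleD.
have hM z : `|1 * h p z + k z| <= 3.
  have := h01 p z; have := h01 q z; have := h01 r z.
  by rewrite /k ler_norml; lra.
(* At each of the three points exactly one bump is [1] and the others vanish, so the three weights
   sum to at most [1]. *)
have : average (E := E) (fun z => 1 * h p z + k z) y <=
       average (E := E) (cst 1) y.
  apply: (average_le HE hc3 c1 hM (c1M 3 _)) => [|z]; first by lra.
  rewrite yp /k /= => -[[->|->]|->]; rewrite !mul1r h1 !hio ?addr0 ?add0r //.
  - by rewrite eq_sym.
  - by rewrite eq_sym.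
  - by rewrite eq_sym.
rewrite avg1 (averageZD HE)// /k (averageZD HE)// !(fP _).2 {1}yp {1}yq yr.
have := (FP p).2 q r Fpq Fpr; have := (FP q).2 p r Fqp Fqr.
have := (FP r).2 p q Frp Frq.
have := pair _ _ pq Fpq Fqp; have := pair _ _ pr Fpr Frp.
have := pair _ _ qr Fqr Frq.
rewrite !ltr_norml; lra.
Qed.
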